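(* Let $m \ge 3$ be odd and $n = 3^m-1$. Then the dual code $\mathcal{C}_{(1,2,m)}^\perp$ has parameters $[n,k,d]$ with $d \ge \frac{3^{(m-1)/2}+9}{2}$ if $m \equiv 3 \pmod 4$ and $d \ge \frac{3^{(m-1)/2}+7}{2}$ if $m \equiv 1 \pmod 4$, and $k = \frac{n-2}{2}$ if $m \equiv 3 \pmod 4$ and $k = \frac{n}{2}$ if $m \equiv 1 \pmod 4$.
   Context: Let $m \ge 2$ be an integer, $n = 3^m-1$, and let $\alpha$ be a primitive element of $\mathbb{F}_{3^m}$. For an integer $0 \le j \le n-1$ with $3$-adic expansion $j = \sum_{t=0}^{m-1} j_t 3^t$, $j_t \in \{0,1,2\}$, let $w_3(j) = \sum_{t=0}^{m-1} j_t$. For distinct $i_1, i_2 \in \{0,1,2,3\}$ let $T_{(i_1,i_2,m)} = \{1 \le j \le n-1 : w_3(j) \equiv i_1 \text{ or } i_2 \pmod 4\}$ and $g_{(i_1,i_2,m)}(x) = \prod_{j \in T_{(i_1,i_2,m)}} (x - \alpha^j) \in \mathbb{F}_3[x]$. $\mathcal{C}_{(i_1,i_2,m)}$ denotes the ternary cyclic code of length $n$ with generator polynomial $g_{(i_1,i_2,m)}(x)$, and $\mathcal{C}^\perp$ denotes the dual code with respect to the standard inner product on $\mathbb{F}_3^n$. Parameters $[n,k,d]$ mean length, dimension over $\mathbb{F}_3$, and minimum Hamming distance. *)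

(* Defs.v *)
From HB Require Import structures.
From mathcomp Require Import all_boot all_order all_algebra all_fingroup all_field.
Set Implicit Arguments. Unset Strict Implicit. Unset Printing Implicit Defensive.
Import GRing.Theory.
Local Open Scope ring_scope.

Definition w3 (m j : nat) : nat := (\sum_(t < m) modn (divn j (3 ^ t)) 3)%N.

Definition Tset (i1 i2 m : nat) (j : nat) : bool :=
  [&& (0 < j)%N, (j < 3 ^ m - 1)%N & ((modn (w3 m j) 4 == i1) || (modn (w3 m j) 4 == i2))].

Definition gen_poly (F : fieldExtType 'F_3) (alpha : F) (i1 i2 m : nat) : {poly F} :=
  \prod_(j < 3 ^ m - 1 | Tset i1 i2 m j) ('X - (alpha ^+ j)%:P).

Definition cyclic_code (F : fieldExtType 'F_3) (n : nat) (g : {poly F})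
  : {set 'rV['F_3]_n} :=
  [set c | g %| map_poly (in_alg F) (rVpoly c)].

Definition dual_code (n : nat) (C : {set 'rV['F_3]_n}) : {set 'rV['F_3]_n} :=
  [set v | [forall c in C, (v *m c^T) == 0]].

Definition code_dim (n : nat) (C : {set 'rV['F_3]_n}) : nat :=
  \dim (<< enum C >>%VS : {vspace 'rV['F_3]_n}).

Definition hdist (n : nat) (u v : 'rV['F_3]_n) : nat :=
  #|[set i : 'I_n | u 0 i != v 0 i]|.

(* Main.v *)
Require Import Defs.
From HB Require Import structures.
From mathcomp Require Import all_boot all_order all_algebra all_fingroup all_field.
From mathcomp Require Import zify ring.
Set Implicit Arguments. Unset Strict Implicit. Unset Printing Implicit Defensive.
Import GRing.Theory.
Local Open Scope ring_scope.

(** The set T_(1,2,m) is stable under multiplication by 3, so the generator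
polynomial has coefficients in F_3, and the dual has dimension #|T_(1,2,m)|,
which is computed from the recurrence for the distribution of w_3 mod 4. For odd
m the identity w_3(n - j) = 2 m - w_3(j) shows that every word c of the dual
vanishes at alpha^j when j = 0 or w_3(j) is 2 or 3 mod 4.

Since j and w_3(j) have the same parity, write n = 2 N, with N odd, and split c
into its even fold c_k + c_(N+k) and its odd fold c_k - c_(N+k), for k < N. The
even fold sees the zeros with w_3(j) = 2 mod 4, the odd fold those with
w_3(j) = 3 mod 4. With m = 2 h + 1, each of the two families of zeros contains a
long arithmetic progression whose step is even and prime to N, namely
- i (3^h - 1) for i <= 3^h, and 3^(2h) + (i + 1) (3^h - 1) for i < 3^h,
  if m = 3 mod 4;
- (i + 1) (3^(h+1) - 1) for i < 3^h, and 3^(2h) + (2 i + 1) (3^h + 1) for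
  2 i + 1 < 3^h, if m = 1 mod 4.
So the BCH argument applies to each fold. If the even fold is zero then the
weight of c is twice that of the odd fold. The even fold is moreover
self-orthogonal, so that its weight is divisible by 3; this is what gives the
bound for m = 3. *)

(** * Ternary digit sums and their distribution modulo 4 *)

Section TernaryWeight.

Local Open Scope nat_scope.

Lemma w3S m j : w3 m.+1 j = j %% 3 + w3 m (j %/ 3).
Proof.
rewrite /w3 big_ord_recl expn0 divn1; congr (_ + _).
by apply: eq_bigr => i _; rewrite lift0 expnS divnMA.
Qed.

(** In base 3, [3 ^ k * y + x] is the block of [k] digits of [x] preceded by the digits of [y]. The
    digit sums along the progressions are read off from such decompositions. *)
Lemma w3_cat k l x y : x < 3 ^ k -> w3 (k + l) (3 ^ k * y + x) = w3 k x + w3 l y.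
Proof.
elim: k x => [|k IHk] x.
  by rewrite expn0 ltnS leqn0 => /eqP ->; rewrite mul1n addn0 /w3 big_ord0.
rewrite expnS => ltx; rewrite addSn !w3S.
have -> : (3 * 3 ^ k * y + x) %% 3 = x %% 3.
  by rewrite -mulnA mulnC -modnDml modnMl add0n.
have -> : (3 * 3 ^ k * y + x) %/ 3 = 3 ^ k * y + x %/ 3.
  by rewrite -mulnA mulnC divnMDl.
by rewrite IHk ?addnA // ltn_divLR // mulnC.
Qed.

Lemma w3_0 m : w3 m 0 = 0.
Proof. by rewrite /w3 big1 // => i _; rewrite div0n. Qed.

Lemma w3_widen k l x : x < 3 ^ k -> w3 (k + l) x = w3 k x.
Proof. by move=> ltx; rewrite -[x in LHS]add0n -(muln0 (3 ^ k)) w3_cat // w3_0 addn0. Qed.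

(** No borrow occurs in [3 ^ k - 1 - x]: each digit [d] becomes [2 - d]. *)
Lemma w3_compl k x : x < 3 ^ k -> w3 k (3 ^ k - 1 - x) + w3 k x = 2 * k.
Proof.
elim: k x => [|k IHk] x ltx; first by rewrite /w3 !big_ord0.
move: ltx; rewrite expnS => ltx.
have lt' : x %/ 3 < 3 ^ k by rewrite ltn_divLR // mulnC.
rewrite !w3S mulnS -(IHk (x %/ 3)) //.
have -> : (3 * 3 ^ k - 1 - x) %/ 3 = 3 ^ k - 1 - x %/ 3 by lia.
have -> : (3 * 3 ^ k - 1 - x) %% 3 = 2 - x %% 3 by lia.
lia.
Qed.

Lemma odd_w3 m j : j < 3 ^ m -> odd (w3 m j) = odd j.
Proof.
elim: m j => [|m IHm] j; first by rewrite ltnS leqn0 => /eqP ->; rewrite w3_0.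
rewrite expnS => ltj; rewrite w3S oddD IHm; last by rewrite ltn_divLR // mulnC.
lia.
Qed.

Lemma w3_opp m j : j < 3 ^ m -> w3 m (3 ^ m - 1 - j) = 2 * m - w3 m j.
Proof. by move=> /w3_compl <-; rewrite addnK. Qed.

(** Modulo [3 ^ m - 1], multiplication by 3 rotates the digits cyclically, the leading digit
    becoming the last one. *)
Lemma w3_mul3 m j : 0 < m -> j < 3 ^ m - 1 -> w3 m ((3 * j) %% (3 ^ m - 1)) = w3 m j.
Proof.
case: m => // m _ ltj.
have p0 : 0 < 3 ^ m by rewrite expn_gt0.
have lta : j %% 3 ^ m < 3 ^ m by rewrite ltn_mod.
have ltb : j %/ 3 ^ m < 3 by rewrite ltn_divLR //; rewrite expnS in ltj; lia.
move: (divn_eq j (3 ^ m)); set b := j %/ _ in ltb *; set a := j %% _ in lta * => jE.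
have -> : (3 * j) %% (3 ^ m.+1 - 1) = 3 * a + b.
  move: ltj; rewrite expnS jE => ltj.
  have -> : 3 * (b * 3 ^ m + a) = b * (3 * 3 ^ m - 1) + (3 * a + b).
    by rewrite mulnBr muln1 mulnDr !mulnA [3 * b]mulnC; nia.
  (* The bound [3 * a + b < 3 ^ m.+1 - 1] could fail only if all digits were 2, that is for
     [j = 3 ^ m.+1 - 1], which [ltj] excludes. *)
  by rewrite modnMDl modn_small //; case: b ltb ltj {jE} => [|[|[|]]] //; lia.
have -> : (3 * a + b) = 3 ^ 1 * a + b by [].
rewrite -[in LHS](add1n m) w3_cat // -[m.+1]addn1 jE mulnC w3_cat //.
have w1 x : x < 3 -> w3 1 x = x.
  by move=> ltx; rewrite /w3 big_ord1 expn0 divn1 modn_small.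
by rewrite !w1 // addnC.
Qed.

Definition w3_count m r := \sum_(j < 3 ^ m) ((w3 m j + r) %% 4 == 0).

(** Splitting off the last digit 0, 1 or 2 shifts the residue by that digit. *)
Lemma w3_countS m r :
  w3_count m.+1 r = w3_count m r + w3_count m r.+1 + w3_count m r.+2.
Proof.
rewrite /w3_count -(big_mkord xpredT (fun j => ((w3 m.+1 j + r) %% 4 == 0) : nat)).
rewrite -!(big_mkord xpredT (fun j => ((w3 m j + _) %% 4 == 0) : nat)).
have -> F : \sum_(0 <= j < 3 ^ m.+1) F j
   = \sum_(0 <= j < 3 ^ m) (F (3 * j) + F (3 * j + 1) + F (3 * j + 2)).
  rewrite expnS; elim: (3 ^ m) => [|k IHk]; first by rewrite muln0 !big_nil.
  by rewrite mulnS addnC !addnS addn0 !big_nat_recr //= IHk !addnA !addn1 addn2.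
rewrite -!big_split /=; apply: eq_bigr => j _.
have D b : b < 3 -> w3 m.+1 (3 * j + b) = w3 m j + b.
  move=> ltb; rewrite w3S addnC mulnC divnMDl // (divn_small ltb) addn0.
  by rewrite modnMDl modn_small.
have := D 0; rewrite addn0 => -> //; rewrite !D //.
by congr (_ + _ + _); rewrite -!addnA ?add1n ?add2n.
Qed.

Lemma w3_countD4 m r : w3_count m r.+4 = w3_count m r.
Proof. by apply: eq_bigr => j _; rewrite -addn4 addnA modnDr. Qed.

(* The values come from evaluating [(1 + x + x^2)^m], the generating function of
   [w3 m], at the fourth roots of unity. Note that [w3_count m r] counts the [j]
   with [w3 m j] congruent to [- r]. *)
Lemma w3_countE m :
  let v k := 4 * w3_count m k in
  [/\ m %% 4 = 0 -> [/\ v 0 = 3 ^ m + 3, v 3 + 1 = 3 ^ m, v 2 + 1 = 3 ^ m & v 1 + 1 = 3 ^ m],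
      m %% 4 = 1 -> [/\ v 0 = 3 ^ m + 1, v 3 = 3 ^ m + 1, v 2 = 3 ^ m + 1 & v 1 + 3 = 3 ^ m],
      m %% 4 = 2 -> [/\ v 0 + 1 = 3 ^ m, v 3 + 1 = 3 ^ m, v 2 = 3 ^ m + 3 & v 1 + 1 = 3 ^ m] &
      m %% 4 = 3 -> [/\ v 0 = 3 ^ m + 1, v 3 + 3 = 3 ^ m, v 2 = 3 ^ m + 1 & v 1 = 3 ^ m + 1]].
Proof.
elim: m => [|m [IH0 IH1 IH2 IH3]] v.
  by split=> // _; rewrite /v /w3_count !expn0 !big_ord1 !w3_0.
have vE k : v k = 4 * (w3_count m k + w3_count m k.+1 + w3_count m k.+2).
  by rewrite /v w3_countS.
rewrite !vE !w3_countD4 expnS.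
split=> mE.
- by have [] := IH3 ltac:(lia); split; lia.
- by have [] := IH0 ltac:(lia); split; lia.
- by have [] := IH1 ltac:(lia); split; lia.
- by have [] := IH2 ltac:(lia); split; lia.
Qed.

(** The two counts also include [j = 3 ^ m - 1], whose digit sum [2 * m] is 2 mod 4 for odd [m], but
    which lies outside [Tset]; hence the [+ 1]. *)
Lemma card_Tset12 m : odd m ->
  #|[pred j : 'I_(3 ^ m - 1) | Tset 1 2 m j]| + 1 = w3_count m 3 + w3_count m 2.
Proof.
move=> modd; rewrite -sum1_card big_mkcond /=.
rewrite /w3_count -!(big_mkord xpredT (fun j => ((w3 m j + _) %% 4 == 0) : nat)).
rewrite -big_split /=.
have p0 : 0 < 3 ^ m by rewrite expn_gt0.
have -> F : \sum_(0 <= j < 3 ^ m) F j = \sum_(0 <= j < 3 ^ m - 1) F j + F (3 ^ m - 1).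
  by rewrite -[in LHS](subnK p0) addn1 big_nat_recr.
rewrite big_mkord; congr (_ + _).
  apply: eq_bigr => j _; rewrite inE /Tset ltn_ord /=.
  have [->|] := posnP j; first by rewrite w3_0.
  by move=> _; case: eqP; case: eqP; case: eqP; case: eqP => /=; lia.
have := @w3_compl m 0 p0; rewrite w3_0 subn0 addn0 => ->.
by case: eqP; case: eqP; lia.
Qed.

End TernaryWeight.

(* Pairing with the polynomial that vanishes at the points of the support
   other than [x k] isolates the coefficient [f k]. *)
Lemma sparse_power_sums_eq0 (K : fieldType) (I : finType) (f y x : I -> K) L :
    injective x -> (forall k, y k != 0) ->
    (forall i, (i < L)%N -> \sum_k f k * y k * x k ^+ i = 0) ->
    (\sum_k (f k != 0%R) <= L)%N ->
  forall k, f k = 0.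
Proof.
move=> xI y0 sum0 leL k; apply/eqP; apply: contraTT leL => fk; rewrite -ltnNge.
pose P l := (f l != 0) && (l != k).
pose p := \prod_(l | P l) ('X - (x l)%:P).
have sp : size p = (\sum_l (f l != 0%R))%N.
  rewrite /p -big_filter size_prod_XsubC size_filter -sum1_count.
  rewrite [RHS](bigD1 k) //= fk add1n; congr _.+1.
  rewrite [LHS]big_mkcond [RHS]big_mkcond /=.
  by apply: eq_bigr => l _; rewrite /P; case: (f l != 0); case: (l != k).
rewrite ltnNge -sp; apply/negP => leL.
have : \sum_l f l * y l * p.[x l] = 0.
  rewrite (eq_bigr (fun l => \sum_(i < L) p`_i * (f l * y l * x l ^+ i))).
    by rewrite exchange_big big1 // => i _; rewrite -mulr_sumr sum0 ?mulr0.
  move=> l _; rewrite (horner_coef_wide _ leL) mulr_sumr.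
  by apply: eq_bigr => i _; rewrite mulrCA.
rewrite (bigD1 k) //= big1 => [|l lk]; last first.
  have [->|fl] := eqVneq (f l) 0; first by rewrite !mul0r.
  by rewrite /p (bigD1 l) ?hornerM ?hornerXsubC ?subrr ?mul0r ?mulr0 // /P fl.
apply/eqP; rewrite addr0 !mulf_neq0 // horner_prod prodf_seq_neq0.
apply/allP => l _; apply/implyP => /andP[_ lk].
by rewrite hornerXsubC subr_eq0 (inj_eq xI) eq_sym.
Qed.

(** * Generator matrices of cyclic codes and their duals *)

Definition gen_mx (K : fieldType) (r n : nat) (g : {poly K}) : 'M[K]_(r, n) :=
  \matrix_(i < r) poly_rV ('X^i * g).

Section GeneratorMatrix.

Variables (K : fieldType) (r n : nat) (g : {poly K}).
Hypotheses (g0 : g != 0) (szg : (size g + r)%N = n.+1).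

Lemma mulmx_gen_mx (q : 'rV_r) : q *m gen_mx r n g = poly_rV (rVpoly q * g).
Proof.
apply/rowP=> j; rewrite !mxE {2}(row_sum_delta q) linear_sum mulr_suml coef_sum.
apply: eq_bigr => i _; rewrite linearZ /= rVpoly_delta !mxE.
by rewrite -scalerAl coefZ.
Qed.

Let size_gM (q : 'rV_r) : (size (rVpoly q * g)%R <= n)%N.
Proof.
rewrite (leq_trans (size_polyMleq _ _)) //.
have : (size (rVpoly q) <= r)%N by exact: size_poly.
lia.
Qed.

Lemma gen_mxP (c : 'rV_n) :
  reflect (exists q, c = q *m gen_mx r n g) (g %| rVpoly c).
Proof.
apply: (iffP idP) => [/dvdpP[q cE] | [q ->]]; last first.
  by rewrite mulmx_gen_mx poly_rV_K // dvdp_mull.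
have sq : (size q <= r)%N.
  have [->|q0] := eqVneq q 0; first by rewrite size_poly0.
  have : (size (rVpoly c) <= n)%N by exact: size_poly.
  rewrite cE size_mul // -ltnS -szg prednK ?ltn_addr ?size_poly_gt0 //.
  by rewrite addnC leq_add2l.
by exists (poly_rV q); rewrite mulmx_gen_mx poly_rV_K // -cE rVpolyK.
Qed.

Lemma row_free_gen_mx : row_free (gen_mx r n g).
Proof.
apply: inj_row_free => q; rewrite mulmx_gen_mx => /(congr1 rVpoly).
rewrite poly_rV_K // linear0 => /eqP; rewrite mulf_eq0 (negPf g0) orbF => /eqP q0.
by rewrite -[q]rVpolyK q0 linear0.
Qed.

End GeneratorMatrix.

Lemma map_gen_mx (K L : fieldType) (f : {rmorphism K -> L}) r n (g : {poly K}) :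
  map_mx f (gen_mx r n g) = gen_mx r n (map_poly f g).
Proof.
by apply/matrixP => i j; rewrite !mxE -(map_polyXn f) -rmorphM coef_map.
Qed.

Lemma dual_codeP n (C : {set 'rV['F_3]_n}) v :
  reflect (forall c, c \in C -> v *m c^T = 0) (v \in dual_code C).
Proof.
rewrite inE; apply: (iffP forall_inP) => H c cC; first exact/eqP/H.
exact/eqP/H.
Qed.

Lemma dual_codeB n (C : {set 'rV['F_3]_n}) u v :
  u \in dual_code C -> v \in dual_code C -> u - v \in dual_code C.
Proof.
move=> /dual_codeP uC /dual_codeP vC; apply/dual_codeP => c cC.
by rewrite mulmxBl uC ?vC ?subrr.
Qed.

Section CyclicDual.

Variables (F : fieldExtType 'F_3) (r n : nat) (g : {poly 'F_3}).
Hypotheses (g0 : g != 0) (szg : (size g + r)%N = n.+1).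

Local Notation C := (dual_code (cyclic_code n (map_poly (in_alg F) g))).

Lemma dual_cyclicE v : (v \in C) = (v *m (gen_mx r n g)^T == 0).
Proof.
apply/dual_codeP/eqP => [vC | vG c].
  apply/rowP => i; rewrite [RHS]mxE.
  suff: (v *m (row i (gen_mx r n g))^T) 0 0 = 0.
    by move=> vi; rewrite -[RHS]vi !mxE; apply: eq_bigr => j _; rewrite !mxE.
  rewrite vC ?mxE // inE dvdp_map; apply/(gen_mxP g0 szg).
  by exists 'e_i; rewrite rowE.
rewrite inE dvdp_map => /(gen_mxP g0 szg)[q ->].
by rewrite trmx_mul mulmxA vG mul0mx.
Qed.

(** The dual is the kernel of [v *m G], which is onto because the rows of the generator matrix are
    free; rank-nullity gives [n - r], the degree of [g]. *)
Lemma code_dim_dual_cyclic : code_dim C = (size g).-1.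
Proof.
pose G : 'M['F_3]_(n, r) := (gen_mx r n g)^T.
pose f : {linear 'rV_n -> 'rV_r} := mulmxr G.
have -> : code_dim C = \dim (lker (linfun f)).
  rewrite /code_dim; congr (\dim _); apply/eqP; rewrite eqEsubv; apply/andP; split.
    apply/span_subvP => v; rewrite mem_enum dual_cyclicE memv_ker lfunE /= => /eqP ->.
    by [].
  apply/subvP => v; rewrite memv_ker lfunE /= => vG.
  by rewrite memv_span // mem_enum dual_cyclicE.
have := limg_ker_dim (linfun f) fullv; rewrite capfv.
have -> : (linfun f @: fullv)%VS = fullv.
  apply/eqP; rewrite eqEsubv subvf; apply/subvP => y _.
  have /row_freeP[B GB] := row_free_gen_mx g0 szg.
  have -> : y = linfun f (y *m B^T).
    by rewrite lfunE /= -mulmxA -trmx_mul GB trmx1 mulmx1.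
  by rewrite memv_img ?memvf.
by rewrite !dimvf !dim_matrix; lia.
Qed.

(* The dual over ['F_3] still annihilates the multiples of [g] over [F], since
   these are [F]-combinations of the rows of the generator matrix. *)
Lemma dual_cyclic_ext v (c : 'rV[F]_n) :
  v \in C -> map_poly (in_alg F) g %| rVpoly c ->
  map_mx (in_alg F) v *m c^T = 0.
Proof.
rewrite dual_cyclicE => /eqP vG.
have mg0 : map_poly (in_alg F) g != 0 by rewrite map_poly_eq0.
have szmg : (size (map_poly (in_alg F) g) + r)%N = n.+1 by rewrite size_map_poly.
move=> /(gen_mxP mg0 szmg)[q ->].
by rewrite -map_gen_mx trmx_mul mulmxA map_trmx -map_mxM vG map_mx0 mul0mx.
Qed.

End CyclicDual.

Lemma coprime_modn_mulI n s k l : coprime n s -> (k < n)%N -> (l < n)%N ->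
  s * k = s * l %[mod n] -> k = l.
Proof.
move=> cns; wlog lekl : k l / (k <= l)%N => [H|] ltk ltl.
  by case/orP: (leq_total k l) => le e; [|symmetry]; apply: H.
move/eqP; rewrite eq_sym eqn_mod_dvd ?leq_mul2l ?lekl ?orbT // -mulnBr Gauss_dvdr //.
have [/eqP|kl /dvdn_leq] := posnP (l - k); lia.
Qed.

(** Since [x ^+ 3 - x] factors as [x * (x - 1) * (x + 1)], the elements fixed by cubing are 0, 1 and
    -1. *)
Lemma cube_fixed_in_alg (F : fieldExtType 'F_3) (p : {poly F}) :
  (forall i, p`_i ^+ 3 = p`_i) -> exists p0, p = map_poly (in_alg F) p0.
Proof.
move=> pF.
pose inv (a : F) : 'F_3 := if a == 0 then 0 else if a == 1 then 1 else -1.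
exists (map_poly inv p); apply/polyP => i.
rewrite coef_map coef_map_id0 /inv ?eqxx //=.
have /eqP : p`_i * (p`_i - 1) * (p`_i + 1) = 0.
  have -> : p`_i * (p`_i - 1) * (p`_i + 1) = p`_i ^+ 3 - p`_i by ring.
  by rewrite pF subrr.
rewrite !mulf_eq0 subr_eq0 addr_eq0 -orbA.
have [->|_] := eqVneq p`_i 0; first by rewrite scale0r.
have [->|_] := eqVneq p`_i 1; first by rewrite scale1r.
by move=> /eqP ->; rewrite scaleN1r.
Qed.

(** * The generator polynomial: descent to F_3, degree and zeros of the dual *)

Section GenPoly.

Variables (F : fieldExtType 'F_3) (m : nat) (alpha : F).
Hypotheses (m_gt0 : (0 < m)%N) (prim : (3 ^ m - 1).-primitive_root alpha).
Let n := (3 ^ m - 1)%N.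

Let n_gt0 : (0 < n)%N. Proof. exact: prim_order_gt0 prim. Qed.

Let coprime_n3 : coprime n 3.
Proof.
rewrite coprime_sym prime_coprime // /n; apply/negP => /dvdnP[k].
by case: (m) m_gt0 => // m' _; rewrite expnS; lia.
Qed.

Lemma Tset_mul3 i1 i2 j : (j < n)%N ->
  Tset i1 i2 m ((3 * j) %% n) = Tset i1 i2 m j.
Proof.
move=> ltj; rewrite /Tset w3_mul3 // ltn_mod -/n n_gt0 ltj /=; congr (_ && _).
rewrite !lt0n; congr (~~ _); rewrite -[_ == 0%N]/(n %| 3 * j)%N.
rewrite Gauss_dvdr //; have [->|j0] := posnP j; first by rewrite dvdn0.
by rewrite gtnNdvd // eqn0Ngt j0.
Qed.

(** Frobenius permutes the roots [alpha ^+ j], because [Tset] is stable under multiplication by 3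
    modulo [n]; so it fixes every coefficient. *)
Lemma gen_poly_F3 i1 i2 :
  exists g0, gen_poly alpha i1 i2 m = map_poly (in_alg F) g0.
Proof.
have ch3 : 3 \in [pchar F] by rewrite pchar_lalg pchar_Fp.
apply: cube_fixed_in_alg => i.
rewrite -(pFrobenius_autE ch3) -coef_map; congr ((polyseq _)`_i).
rewrite /gen_poly map_prod_XsubC /=.
pose s (j : 'I_n) : 'I_n := Ordinal (ltn_pmod (3 * j) n_gt0).
have sI : injective s.
  move=> j k /(congr1 val) /= jk.
  by apply: val_inj; exact: coprime_modn_mulI coprime_n3 (ltn_ord j) (ltn_ord k) jk.
rewrite [RHS](reindex_inj sI) /=; apply: eq_big => j.
  by rewrite Tset_mul3.
by move=> _; rewrite pFrobenius_autE (prim_expr_mod prim) -exprM mulnC.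
Qed.

Lemma size_gen_poly i1 i2 :
  size (gen_poly alpha i1 i2 m) = #|[pred j : 'I_n | Tset i1 i2 m j]|.+1.
Proof.
rewrite /gen_poly -big_filter size_prod_XsubC size_filter -sum1_count -sum1_card.
by congr _.+1; apply: eq_bigl => j; rewrite inE.
Qed.

Lemma dvdp_gen_poly i1 i2 (p : {poly F}) :
  (forall j, Tset i1 i2 m j -> root p (alpha ^+ j)) ->
  gen_poly alpha i1 i2 m %| p.
Proof.
move=> rp; rewrite /gen_poly -big_filter.
rewrite -(big_map (fun j : 'I_n => alpha ^+ j) xpredT (fun z => 'X - z%:P)).
apply: uniq_roots_dvdp.
  by apply/allP => z /mapP[j]; rewrite mem_filter => /andP[Tj _] ->; apply: rp.
rewrite uniq_rootsE map_inj_in_uniq ?filter_uniq ?index_enum_uniq // => j k _ _ /eqP.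
rewrite (eq_prim_root_expr prim) !modn_small // => /eqP jk; exact: val_inj.
Qed.

Lemma code_dim_dual_gen i1 i2 :
  code_dim (dual_code (cyclic_code n (gen_poly alpha i1 i2 m)))
  = #|[pred j : 'I_n | Tset i1 i2 m j]|.
Proof.
have sz := size_gen_poly i1 i2; have [g gE] := gen_poly_F3 i1 i2.
have g0 : g != 0 by rewrite -(map_poly_eq0 (in_alg F)) -gE -size_poly_eq0 sz.
rewrite gE size_map_poly in sz *.
have szg : (size g + (n - #|[pred j : 'I_n | Tset i1 i2 m j]|))%N = n.+1.
  by rewrite sz addSn subnKC // (leq_trans (max_card _)) ?card_ord.
by rewrite (code_dim_dual_cyclic _ g0 szg) sz.
Qed.

(* The evaluation point [alpha ^+ j] gives the word [(alpha ^+ (j * k))_k], whose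
   only nonzero is at the exponent [- j]. *)
Lemma dual_gen_zero i1 i2 (v : 'rV_n) j :
    v \in dual_code (cyclic_code n (gen_poly alpha i1 i2 m)) ->
    (j <= n)%N -> ~~ Tset i1 i2 m (n - j) ->
  (map_poly (in_alg F) (rVpoly v)).[alpha ^+ j] = 0.
Proof.
move=> vC lej nT; pose c : 'rV[F]_n := \row_k (alpha ^+ (j * k)).
have sz := size_gen_poly i1 i2; have [g gE] := gen_poly_F3 i1 i2.
have g0 : g != 0 by rewrite -(map_poly_eq0 (in_alg F)) -gE -size_poly_eq0 sz.
have gc : gen_poly alpha i1 i2 m %| rVpoly c.
  apply: dvdp_gen_poly => i Ti; rewrite /root.
  rewrite (horner_coef_wide _ (size_poly _ _)).
  rewrite (eq_bigr (fun k : 'I_n => (alpha ^+ (j + i)) ^+ k)); last first.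
    by move=> k _; rewrite coef_rVpoly_ord mxE -!exprM -exprD mulnDl.
  (* The sum is geometric with ratio an [n]-th root of unity, so it vanishes unless the ratio is
     1. *)
  have : (alpha ^+ (j + i)) ^+ n - 1 = 0.
    by rewrite exprAC (prim_expr_order prim) expr1n subrr.
  move/eqP; rewrite subrX1 mulf_eq0 => /orP[|//].
  rewrite subr_eq0 -(prim_order_dvd prim) => /dvdnP[q jiq].
  case/negP: nT; case/and3P: (Ti) => i0; rewrite -/n => ltin _.
  (* With [0 < i < n] and [j <= n], the multiple [j + i] of [n] can only be [n] itself. *)
  suff -> : (n - j)%N = i by [].
  by case: q jiq => [|[|q]]; rewrite ?mulSn -/n; lia.
rewrite gE in vC gc; rewrite gE size_map_poly in sz.
have szg : (size g + (n - #|[pred j : 'I_n | Tset i1 i2 m j]|))%N = n.+1.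
  by rewrite sz addSn subnKC // (leq_trans (max_card _)) ?card_ord.
have := dual_cyclic_ext g0 szg vC gc => /rowP/(_ 0); rewrite !mxE => <-.
rewrite (@horner_coef_wide _ n); last by rewrite size_map_poly size_poly.
by apply: eq_bigr => k _; rewrite coef_map coef_rVpoly_ord !mxE exprM.
Qed.

End GenPoly.

(** * Folding a word of length [2 * N] into two words of length [N] *)

Lemma big_halves (R : Type) (idx : R) (op : Monoid.com_law idx) N (f : nat -> R) :
  \big[op/idx]_(k < 2 * N) f k = \big[op/idx]_(k < N) op (f k) (f (N + k)%N).
Proof. by rewrite mul2n -addnn big_split_ord /= big_split. Qed.

Section Folding.

Variables (F : fieldType) (N : nat) (alpha : F) (P : {poly F}).
Hypotheses (prim : (2 * N).-primitive_root alpha) (szP : (size P <= 2 * N)%N).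

Let N_gt0 : (0 < N)%N.
Proof. by move: (prim_order_gt0 prim); rewrite muln_gt0. Qed.

Lemma prim_root_half : alpha ^+ N = -1.
Proof.
have : (alpha ^+ N) ^+ 2 == 1 by rewrite -exprM mulnC prim_expr_order.
rewrite sqrf_eq1 -(prim_order_dvd prim) => /orP[/dvdn_leq | /eqP //]; lia.
Qed.

(** For [k < N] these are the coefficients of [P] reduced modulo [X^N - 1] ([b = false]) or
    [X^N + 1] ([b = true]). *)
Definition fold (b : bool) k := P`_k + (-1) ^+ b * P`_(N + k).

Lemma horner_fold j :
  P.[alpha ^+ j] = \sum_(k < N) fold (odd j) k * (alpha ^+ j) ^+ k.
Proof.
rewrite (horner_coef_wide _ szP) (big_halves _ _ (fun k => P`_k * (alpha ^+ j) ^+ k)).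
apply: eq_bigr => k _; rewrite mulrDl; congr (_ + _).
by rewrite exprD [(alpha ^+ j) ^+ N]exprAC prim_root_half signr_odd mulrCA mulrA.
Qed.

(** BCH argument for one fold: as [s] is even, all exponents have the parity of [a] and see the same
    fold; as [s] is prime to [N], the [N] locators [(alpha ^+ s) ^+ k] are distinct. *)
Lemma fold_eq0 L a s : coprime N s -> ~~ odd s ->
    (forall i, (i < L)%N -> P.[alpha ^+ (a + s * i)] = 0) ->
    (\sum_(k < N) (fold (odd a) k != 0%R) <= L)%N ->
  forall k, (k < N)%N -> fold (odd a) k = 0.
Proof.
move=> cNs es P0 leL k ltk.
pose x (k : 'I_N) := (alpha ^+ s) ^+ k; pose y (k : 'I_N) := (alpha ^+ a) ^+ k.
have a0 : alpha != 0.
  apply/eqP => a0; have /eqP := prim_root_half.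
  by rewrite a0 expr0n gtn_eqF // eq_sym oppr_eq0 oner_eq0.
apply: (@sparse_power_sums_eq0 _ _ (fun k : 'I_N => fold (odd a) k) y x L _ _ _ leL (Ordinal ltk)).
- move=> i j /eqP; rewrite /x -!exprM (eq_prim_root_expr prim) => /eqP ij.
  apply/val_inj/(coprime_modn_mulI cNs (ltn_ord i) (ltn_ord j)).
  have dN : (N %| 2 * N)%N by rewrite dvdn_mull.
  by rewrite -(modn_dvdm _ dN) ij modn_dvdm.
- by move=> i; rewrite !expf_neq0.
- move=> i /P0; rewrite horner_fold => Pi0; rewrite -[RHS]Pi0; apply: eq_bigr => l _.
  rewrite oddD oddM (negPf es) addbF -mulrA; congr (_ * _).
  by rewrite /x /y -!exprM -exprD; congr (_ ^+ _); lia.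
Qed.

Lemma wt_fold_le b :
  (\sum_(k < N) (fold b k != 0%R) <= \sum_(k < 2 * N) ((P`_k)%R != 0%R))%N.
Proof.
rewrite (big_halves _ _ (fun k => (P`_k != 0) : nat)); apply: leq_sum => k _ /=.
rewrite /fold; have [->|] := eqVneq P`_k 0; last by move=> _; case: eqP.
have [->|] := eqVneq P`_(N + k) 0; last by move=> _; case: eqP.
by rewrite mulr0 addr0 eqxx.
Qed.

Lemma wt_fold_even0 : 2%:R != 0 :> F ->
  (forall k, (k < N)%N -> fold false k = 0) ->
  (\sum_(k < 2 * N) ((P`_k)%R != 0%R) = 2 * \sum_(k < N) (fold true k != 0%R))%N.
Proof.
move=> two0 f0; rewrite (big_halves _ _ (fun k => (P`_k != 0) : nat)) big_distrr.
apply: eq_bigr => k _ /=.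
have := f0 k (ltn_ord k); rewrite /fold expr0 expr1 mul1r mulN1r.
move=> /eqP; rewrite addrC addr_eq0 => /eqP ->.
by rewrite opprK oppr_eq0 -mulr2n -mulr_natl mulf_eq0 (negPf two0) addnn mul2n.
Qed.

(** If the even fold is light, it is zero and the weight of [P] is twice that of the odd fold. The
    odd fold cannot be light too: both folds would vanish, and [P] with them since 2 is
    invertible. *)
Lemma fold_distance L1 L2 a1 s1 a2 s2 : 2%:R != 0 :> F -> P != 0 ->
    ~~ odd a1 -> ~~ odd s1 -> coprime N s1 ->
    (forall i, (i < L1)%N -> P.[alpha ^+ (a1 + s1 * i)] = 0) ->
    odd a2 -> ~~ odd s2 -> coprime N s2 ->
    (forall i, (i < L2)%N -> P.[alpha ^+ (a2 + s2 * i)] = 0) ->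
  (L1 < \sum_(k < N) (fold false k != 0%R))%N \/
  (2 * L2 < \sum_(k < 2 * N) ((P`_k)%R != 0%R))%N.
Proof.
move=> two0 P0 oa1 es1 c1 Z1 oa2 es2 c2 Z2.
have [le1|] := leqP (\sum_(k < N) (fold false k != 0%R))%N L1; last by left.
right; have f0 : forall k, (k < N)%N -> fold false k = 0.
  by move: (fold_eq0 c1 es1 Z1); rewrite (negPf oa1); apply.
rewrite wt_fold_even0 // ltn_pmul2l // ltnNge; apply/negP => le2.
have := fold_eq0 c2 es2 Z2; rewrite oa2 => /(_ le2) g0.
case/eqP: P0; apply/polyP => k; rewrite coef0.
have aE l : (l < N)%N -> P`_l = 0.
  move=> ltl; apply: (mulfI two0); rewrite mulr0.
  have -> : 2%:R * P`_l = fold false l + fold true l by rewrite /fold /=; ring.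
  by rewrite f0 ?g0 ?addr0.
have [/aE // | leNk] := ltnP k N.
have [leP | ltk] := leqP (2 * N) k; first by rewrite nth_default ?(leq_trans szP).
have ltkN : (k - N < N)%N by lia.
have := f0 _ ltkN; rewrite /fold aE // add0r expr0 mul1r.
by rewrite subnKC.
Qed.

(* Expand the sum over [i] of [P.[alpha ^+ (2 * i)] * P.[alpha ^+ (2 * (N - i))]]:
   orthogonality of characters leaves only the diagonal. *)
Lemma fold_self_orthogonal : N%:R != 0 :> F ->
  (forall i, (i < N)%N -> P.[alpha ^+ (2 * i)] = 0 \/ P.[alpha ^+ (2 * (N - i))] = 0) ->
  \sum_(k < N) fold false k ^+ 2 = 0.
Proof.
move=> N0 PP0.
have xN q : (alpha ^+ (2 * q)) ^+ N = 1.
  by rewrite -exprM mulnAC exprM (prim_expr_order prim) expr1n.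
have : \sum_(i < N) P.[alpha ^+ (2 * i)] * P.[alpha ^+ (2 * (N - i))] = 0.
  by apply: big1 => i _; case: (PP0 i) => // ->; rewrite ?mul0r ?mulr0.
rewrite (eq_bigr (fun i : 'I_N => \sum_(k < N) \sum_(l < N)
   fold false k * fold false l * ((alpha ^+ (2 * k)) ^+ i * (alpha ^+ (2 * l)) ^+ (N - i)))).
  rewrite exchange_big /=; under eq_bigr do rewrite exchange_big /=.
  move=> sum0; apply: (mulfI N0); rewrite mulr0 -[RHS]sum0 mulr_sumr.
  apply: eq_bigr => k _; rewrite (bigD1 k) //= [X in _ = _ + X]big1.
    rewrite addr0 -mulr_sumr mulrC expr2; congr (_ * _).
    rewrite (eq_bigr (fun=> 1)) ?sumr_const ?card_ord // => i _.
    by rewrite -exprD subnKC 1?ltnW.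
  move=> l lk; rewrite -mulr_sumr; set y := alpha ^+ (2 * k); set z := alpha ^+ (2 * l).
  have yz : y - z != 0.
    rewrite subr_eq0 (eq_prim_root_expr prim) !modn_small ?ltn_pmul2l //.
    by rewrite eqn_mul2l /= eq_sym.
  (* Multiplied by [y - z], the sum telescopes to [y ^+ N - z ^+ N = 1 - 1]. *)
  have zy : \sum_(i < N) y ^+ i * z ^+ (N.-1 - i) = 0.
    apply: (mulfI yz); rewrite mulr0.
    have -> : \sum_(i < N) y ^+ i * z ^+ (N.-1 - i) = \sum_(i < N) y ^+ (N.-1 - i) * z ^+ i.
      rewrite (reindex_inj rev_ord_inj) /=; apply: eq_bigr => i _.
      by congr (_ ^+ _ * _ ^+ _); have := ltn_ord i; lia.
    by rewrite -subrXX !xN subrr.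
  rewrite (eq_bigr (fun i : 'I_N => z * (y ^+ i * z ^+ (N.-1 - i)))).
    by rewrite -mulr_sumr zy !mulr0.
  move=> i _; rewrite mulrCA -exprS; congr (_ * _ ^+ _); have := ltn_ord i; lia.
move=> i _; rewrite !horner_fold !oddM /= mulr_suml; apply: eq_bigr => k _.
rewrite mulr_sumr; apply: eq_bigr => l _.
by rewrite mulrACA -!exprM; congr (_ * (_ ^+ _ * _ ^+ _)); lia.
Qed.

End Folding.

(** * Zeros and weights of the words of the dual *)

Lemma dual12_zero (F : fieldExtType 'F_3) m (alpha : F) v j :
    odd m -> (3 ^ m - 1).-primitive_root alpha ->
    v \in dual_code (cyclic_code (3 ^ m - 1) (gen_poly alpha 1 2 m)) ->
    (j < 3 ^ m - 1)%N -> (j == 0%N) || (1 < w3 m j %% 4)%N ->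
  (map_poly (in_alg F) (rVpoly v)).[alpha ^+ j] = 0.
Proof.
move=> modd prim vC ltj jZ; apply: (dual_gen_zero _ prim vC); rewrite ?odd_gt0 1?ltnW //.
(* For [j = 0] the opposite exponent is [3 ^ m - 1], outside the strict range of [Tset]. *)
case/orP: jZ => [/eqP -> | wj]; first by rewrite /Tset subn0 ltnn andbF.
have lt3 : (j < 3 ^ m)%N by lia.
rewrite /Tset w3_opp // !negb_and !negb_or.
(* As [2 * m] is 2 mod 4, digit sums 2 and 3 mod 4 become 0 and 3. *)
have := w3_compl lt3; lia.
Qed.

Lemma hdistE (F : fieldExtType 'F_3) n (u v : 'rV['F_3]_n) :
  hdist u v = (\sum_(k < n) ((map_poly (in_alg F) (rVpoly (u - v)))`_k != 0)%R)%N.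
Proof.
rewrite /hdist -sum1_card big_mkcond /=; apply: eq_bigr => k _.
by rewrite inE coef_map fmorph_eq0 coef_rVpoly_ord !mxE subr_eq0; case: eqP.
Qed.

(** Nonzero elements of F_3 have square 1, so the sum of squares is the weight modulo 3. *)
Lemma wt_fold_dvd3 (F : fieldExtType 'F_3) N (p : {poly 'F_3}) b :
  \sum_(k < N) fold N (map_poly (in_alg F) p) b k ^+ 2 = 0 ->
  (3 %| \sum_(k < N) (fold N (map_poly (in_alg F) p) b k != 0%R))%N.
Proof.
have ch3 : 3 \in [pchar F] by rewrite pchar_lalg pchar_Fp.
move=> sum0; rewrite (dvdn_pcharf ch3) natr_sum -[X in _ == X]sum0.
apply/eqP/eq_bigr => k _.
have -> : fold N (map_poly (in_alg F) p) b k = in_alg F (fold N p b k).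
  by rewrite /fold !coef_map rmorphD rmorphM rmorphXn rmorphN1.
have sq (x : 'F_3) : x ^+ 2 = (x != 0)%:R.
  by apply/eqP; case: x => [[|[|[|]]] lt3].
by rewrite fmorph_eq0 -rmorphXn sq rmorph_nat.
Qed.

Lemma coprime_odd_dvd2 N s :
  odd N -> (forall d, d %| N -> d %| s -> d %| 2)%N -> coprime N s.
Proof.
move=> oN H; rewrite /coprime.
have := H _ (dvdn_gcdl N s) (dvdn_gcdr N s).
have : odd (gcdn N s) by rewrite (dvdn_odd (dvdn_gcdl _ _)).
by move=> od /dvdn_leq; case: (gcdn _ _) od => [|[|[|]]] //=; lia.
Qed.

(** * Coprimality of the steps with [N] *)

Section Arithmetic.

Local Open Scope nat_scope.
Variables (h N : nat).
Hypothesis nE : 3 ^ (2 * h + 1) = (2 * N).+1.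

(** As [9 ^ h] is 1 mod 8, [2 * N + 1] is 3 mod 8. *)
Lemma odd_half_n : odd N.
Proof.
have : (3 ^ 2) ^ h %% 8 = 1 by rewrite -modnXm exp1n.
by move: nE; rewrite expnD expnM; set x := _ ^ h; lia.
Qed.

(* Modulo a common divisor, [3 ^ (2 * h + 1) = 1] and [3 ^ h = 1] give [3 = 1];
   the other two steps are treated in the same way. *)
Lemma coprime_half_subn1 : coprime N (3 ^ h - 1).
Proof.
apply: coprime_odd_dvd2 odd_half_n _ => d dN ds.
have p0 : 0 < 3 ^ h by rewrite expn_gt0.
have e : 3 * (3 ^ h + 1) * (3 ^ h - 1) + 2 = 2 * N.
  by move: nE; rewrite expnD mul2n -addnn expnD; nia.
by rewrite -(dvdn_addr _ (dvdn_mull (3 * (3 ^ h + 1)) ds)) e dvdn_mull.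
Qed.

Lemma coprime_half_subn1S : coprime N (3 ^ h.+1 - 1).
Proof.
apply: coprime_odd_dvd2 odd_half_n _ => d dN ds.
have p0 : 0 < 3 ^ h by rewrite expn_gt0.
have e : (3 ^ h.+1 + 1) * (3 ^ h.+1 - 1) = 3 * 2 * N + 2.
  by move: nE; rewrite expnS expnD mul2n -addnn expnD; nia.
rewrite -(dvdn_addr _ (dvdn_mull (3 * 2) dN)) -e dvdn_mull //.
Qed.

Lemma coprime_half_addn1 : coprime N (2 * (3 ^ h + 1)).
Proof.
rewrite coprimeMr coprimen2 odd_half_n /=.
apply: coprime_odd_dvd2 odd_half_n _ => d dN ds.
have p0 : 0 < 3 ^ h by rewrite expn_gt0.
have e : 3 * (3 ^ h - 1) * (3 ^ h + 1) + 2 = 2 * N.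
  by move: nE; rewrite expnD mul2n -addnn expnD; nia.
by rewrite -(dvdn_addr _ (dvdn_mull (3 * (3 ^ h - 1)) ds)) e dvdn_mull.
Qed.

End Arithmetic.

(** * Digit sums along the four progressions *)

Section Progressions.

Local Open Scope nat_scope.
Variable h : nat.

(** The digits are the block of [i] followed by its complement [3 ^ h - 1 - i]. *)
Lemma w3_prog_subn1 i : i < 3 ^ h -> w3 (2 * h + 1) (3 ^ h - 1 + (3 ^ h - 1) * i) = 2 * h.
Proof.
move=> lti.
have -> : 3 ^ h - 1 + (3 ^ h - 1) * i = 3 ^ h * i + (3 ^ h - 1 - i) by nia.
have -> : 2 * h + 1 = h + (h + 1) by lia.
by rewrite w3_cat ?w3_widen ?w3_compl //; lia.
Qed.

Lemma w3_prog_subn1_odd i : i < 3 ^ h ->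
  w3 (2 * h + 1) (3 ^ (2 * h) + 3 ^ h - 1 + (3 ^ h - 1) * i) = 2 * h + 1.
Proof.
move=> lti; rewrite mul2n -addnn expnD.
have -> : 3 ^ h * 3 ^ h + 3 ^ h - 1 + (3 ^ h - 1) * i
   = 3 ^ h * (3 ^ h * 1 + i) + (3 ^ h - 1 - i) by nia.
rewrite -addnA w3_cat ?w3_cat //; last by lia.
have -> : w3 1 1 = 1 by rewrite /w3 big_ord1.
by rewrite addnA w3_compl //; lia.
Qed.

Lemma w3_prog_subn1S i : i < 3 ^ h ->
  w3 (2 * h + 1) (3 ^ h.+1 - 1 + (3 ^ h.+1 - 1) * i) = 2 * h.+1.
Proof.
move=> lti.
have le : 3 ^ h <= 3 ^ h.+1 by rewrite leq_exp2l.
have -> : 3 ^ h.+1 - 1 + (3 ^ h.+1 - 1) * i = 3 ^ h.+1 * i + (3 ^ h.+1 - 1 - i) by nia.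
have -> : 2 * h + 1 = h.+1 + h by lia.
rewrite w3_cat -?(w3_widen 1 lti) ?addn1 ?w3_compl //; lia.
Qed.

(** The digits are a leading 1 and two copies of the block of [2 * i + 1]. That block has odd digit
    sum, so the total is 3 mod 4. *)
Lemma w3_prog_addn1 i : 2 * i + 1 < 3 ^ h ->
  w3 (2 * h + 1) (3 ^ (2 * h) + 3 ^ h + 1 + 2 * (3 ^ h + 1) * i)
  = 2 * w3 h (2 * i + 1) + 1.
Proof.
move=> lti; rewrite mul2n -addnn expnD.
have -> : 3 ^ h * 3 ^ h + 3 ^ h + 1 + 2 * (3 ^ h + 1) * i
   = 3 ^ h * (3 ^ h * 1 + (2 * i + 1)) + (2 * i + 1) by nia.
rewrite -addnA !w3_cat //; have -> : w3 1 1 = 1 by rewrite /w3 big_ord1.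
lia.
Qed.

End Progressions.

(** * Weight bounds in the two residue classes of [m] *)

Section Distance.

Variables (F : fieldExtType 'F_3) (h N : nat) (alpha : F) (p : {poly 'F_3}).
Local Notation m := (2 * h + 1)%N.
Local Notation P := (map_poly (in_alg F) p).
Hypotheses (h_gt0 : (0 < h)%N) (nE : (3 ^ m)%N = (2 * N).+1).
Hypotheses (prim : (2 * N).-primitive_root alpha).
Hypotheses (szp : (size p <= 2 * N)%N) (p0 : p != 0).
Hypothesis zero : forall j, (j < 2 * N)%N ->
  (j == 0%N) || (1 < w3 m j %% 4)%N -> P.[alpha ^+ j] = 0.

Let szP : (size P <= 2 * N)%N. Proof. by rewrite size_map_poly. Qed.

Let P_neq0 : P != 0. Proof. by rewrite map_poly_eq0. Qed.

Let two_neq0 : 2%:R != 0 :> F.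
Proof. by rewrite -(rmorph_nat (in_alg F)) fmorph_eq0. Qed.

Let zero_w j : (j < 2 * N)%N -> (1 < w3 m j %% 4)%N -> P.[alpha ^+ j] = 0.
Proof. by move=> ltj wj; apply: zero; rewrite // wj orbT. Qed.

(** For [0 < i < N] the digit sums of [2 * i] and [2 * (N - i)] are even and add up to [2 * m],
    which is 2 mod 4, so one of them is 2 mod 4 and gives a zero. *)
Lemma wt_fold_even_dvd3 : (3 %| \sum_(k < N) (fold N P false k != 0%R))%N.
Proof.
apply/wt_fold_dvd3/(fold_self_orthogonal prim szP).
  have ch3 : 3 \in [pchar F] by rewrite pchar_lalg pchar_Fp.
  rewrite -(dvdn_pcharf ch3); apply/negP => dN.
  have : (3 %| (2 * N).+1)%N by rewrite -nE -{1}[3%N]expn1 dvdn_exp2l // addn1.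
  by rewrite -[(2 * N).+1]addn1 dvdn_addr // dvdn_mull.
move=> i ltiN; have [->|i0] := posnP i.
  by left; apply: zero; rewrite // muln0 muln_gt0 /= (leq_ltn_trans _ ltiN).
have lt2 : (2 * i < 2 * N)%N by rewrite ltn_pmul2l.
have lt3 : (2 * i < 3 ^ m)%N by rewrite nE ltnS ltnW.
have := odd_w3 lt3; rewrite oddM /= => ow.
have [/eqP w2|w0] := boolP (w3 m (2 * i) %% 4 == 2)%N.
  by left; apply: zero_w; rewrite ?w2.
right; apply: zero_w; first by rewrite ltn_pmul2l // ltn_subrL i0 (leq_trans _ ltiN).
have -> : (2 * (N - i) = 3 ^ m - 1 - 2 * i)%N by rewrite nE subn1 mulnBr.
rewrite w3_opp //; have := w3_compl lt3.
by move: (w3 _ (_ - _)) (w3 m (2 * i)) ow w0 => a b; clear; lia.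
Qed.

Let Nsq : (2 * N).+1 = (3 * (3 ^ h * 3 ^ h))%N.
Proof. by rewrite -nE expnD mul2n -addnn expnD mulnC. Qed.

Let h3 : (2 < 3 ^ h)%N. Proof. by rewrite -[3%N]/(3 ^ 1)%N leq_exp2l. Qed.

Let odd3h : odd (3 ^ h)%N. Proof. by rewrite oddX orbT. Qed.

Lemma wt_dual12_mod3 : (m %% 4 = 3)%N ->
  (3 ^ h + 9 <= 2 * \sum_(k < 2 * N) ((P`_k)%R != 0%R))%N.
Proof.
move=> m4.
(* Starting at the zero [j = 0] gains one more term. *)
have Z1 i : (i < (3 ^ h).+1)%N -> P.[alpha ^+ (0 + (3 ^ h - 1) * i)] = 0.
  case: i => [_|i lti].
    by rewrite muln0; apply: zero; rewrite // (prim_order_gt0 prim).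
  rewrite mulnS add0n; apply: zero_w.
    by move: Nsq h3 lti; move: (3 ^ h)%N => x; clear; nia.
  by rewrite w3_prog_subn1 //; move: m4; clear; lia.
have Z2 i : (i < 3 ^ h)%N ->
    P.[alpha ^+ (3 ^ (2 * h) + 3 ^ h - 1 + (3 ^ h - 1) * i)] = 0.
  move=> lti; apply: zero_w; last by rewrite w3_prog_subn1_odd // m4.
  rewrite mul2n -addnn expnD.
  by move: Nsq h3 lti; move: (3 ^ h)%N => x; clear; nia.
have es : ~~ odd (3 ^ h - 1)%N by move: odd3h h3; clear; lia.
have oa : odd (3 ^ (2 * h) + 3 ^ h - 1)%N.
  have : odd (3 ^ (2 * h))%N by rewrite oddX orbT.
  by move: odd3h h3; clear; lia.
have c1 := coprime_half_subn1 nE.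
have [] := fold_distance prim szP two_neq0 P_neq0 (isT : ~~ odd 0) es c1 Z1 oa es c1 Z2.
  (* The even fold has weight above [3 ^ h + 1] and divisible by 3, hence at least [3 ^ h + 3]; this
     is exactly enough when [h = 1]. *)
  have d3h : (3 %| 3 ^ h)%N by rewrite -{1}[3%N]expn1 dvdn_exp2l.
  move: wt_fold_even_dvd3 (wt_fold_le N P false) h3 d3h.
  by move: (\sum_(k < N) _)%N (\sum_(k < 2 * N) _)%N (3 ^ h)%N; clear; lia.
by move: h3; move: (\sum_(k < 2 * N) _)%N (3 ^ h)%N; clear; lia.
Qed.

Lemma wt_dual12_mod1 : (m %% 4 = 1)%N ->
  (3 ^ h + 7 <= 2 * \sum_(k < 2 * N) ((P`_k)%R != 0%R))%N.
Proof.
move=> m4.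
have h2 : (1 < h)%N by move: h_gt0 m4; clear; lia.
have h9 : (8 < 3 ^ h)%N by rewrite -[9%N]/(3 ^ 2)%N leq_exp2l.
have Z1 i : (i < 3 ^ h)%N -> P.[alpha ^+ (3 ^ h.+1 - 1 + (3 ^ h.+1 - 1) * i)] = 0.
  move=> lti; apply: zero_w.
    rewrite expnS.
    by move: Nsq h3 lti; move: (3 ^ h)%N => x; clear; nia.
  by rewrite w3_prog_subn1S //; move: m4; clear; lia.
(* There are [(3 ^ h - 1) / 2] odd numbers [2 * i + 1] below the odd number [3 ^ h]. *)
have Z2 i : (i < (3 ^ h)./2)%N ->
    P.[alpha ^+ (3 ^ (2 * h) + 3 ^ h + 1 + 2 * (3 ^ h + 1) * i)] = 0.
  move=> lti; have lt3 : (2 * i + 1 < 3 ^ h)%N by move: lti odd3h; clear; lia.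
  apply: zero_w; last first.
    by rewrite w3_prog_addn1 //; have := odd_w3 lt3; clear; lia.
  rewrite mul2n -addnn expnD.
  by move: Nsq h3 lt3; move: (3 ^ h)%N => x; clear; nia.
have es1 : ~~ odd (3 ^ h.+1 - 1)%N by rewrite expnS; move: odd3h h3; clear; lia.
have es2 : ~~ odd (2 * (3 ^ h + 1))%N by rewrite oddM.
have oa : odd (3 ^ (2 * h) + 3 ^ h + 1)%N by rewrite addn1 /= oddD !oddX !orbT.
have [] := fold_distance prim szP two_neq0 P_neq0 es1 es1 (coprime_half_subn1S nE) Z1
  oa es2 (coprime_half_addn1 nE) Z2.
  move: (wt_fold_le N P false) h9.
  by move: (\sum_(k < N) _)%N (\sum_(k < 2 * N) _)%N (3 ^ h)%N; clear; lia.
by move: h9; move: (\sum_(k < 2 * N) _)%N (3 ^ h)%N; clear; lia.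
Qed.

End Distance.

Theorem theorem8 (m : nat) (hodd : odd m) (hm : (3 <= m)%N)
  (F : fieldExtType 'F_3) (hdim : \dim {:F} = m)
  (alpha : F) (halpha : (3 ^ m - 1).-primitive_root alpha) :
  let n := (3 ^ m - 1)%N in
  let C := dual_code (cyclic_code n (gen_poly alpha 1 2 m)) in
  (modn m 4 = 3%N ->
     code_dim C = (n - 2)./2 /\
     (forall u v, u \in C -> v \in C -> u != v ->
        (3 ^ (divn (m - 1) 2) + 9 <= 2 * hdist u v)%N)) /\
  (modn m 4 = 1%N ->
     code_dim C = n./2 /\
     (forall u v, u \in C -> v \in C -> u != v ->
        (3 ^ (divn (m - 1) 2) + 7 <= 2 * hdist u v)%N)).
Proof.
move=> n C.
have m_gt0 : (0 < m)%N by rewrite odd_gt0.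
have dimC : code_dim C = #|[pred j : 'I_n | Tset 1 2 m j]|.
  exact: code_dim_dual_gen.
have := card_Tset12 hodd; have [_ cnt1 _ cnt3] := w3_countE m.
rewrite -/n -dimC => cT.
have [h mE] : exists h, m = (2 * h + 1)%N by exists m./2; move: hodd; clear; lia.
have [N nE] : exists N, (3 ^ m)%N = (2 * N).+1.
  have : odd (3 ^ m) by rewrite oddX orbT.
  by exists (3 ^ m)./2; lia.
have nN : n = (2 * N)%N by rewrite /n nE subn1.
have hE : ((m - 1) %/ 2 = h)%N by rewrite mE addnK mulKn.
have h_gt0 : (0 < h)%N by move: hm; rewrite mE; clear; lia.
have wt u v b : u \in C -> v \in C -> u != v ->
    (forall p : {poly 'F_3}, p != 0 -> (size p <= 2 * N)%N ->
       (forall j, (j < 2 * N)%N -> (j == 0%N) || (1 < w3 m j %% 4)%N ->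
          (map_poly (in_alg F) p).[alpha ^+ j] = 0) ->
       (b <= 2 * \sum_(k < 2 * N) ((map_poly (in_alg F) p)`_k != 0)%R)%N) ->
    (b <= 2 * hdist u v)%N.
  move=> uC vC uv H; rewrite (hdistE F) -/n.
  rewrite [X in (_ <= _ * X)%N](congr1 (fun M => \sum_(k < M)
    ((map_poly (in_alg F) (rVpoly (u - v)))`_k != 0)%R)%N nN).
  apply: H; last 1 first.
  - by move=> j ltj; apply: (dual12_zero hodd halpha); rewrite -/n ?nN ?dual_codeB.
  - apply: contra uv => /eqP uv0.
    by rewrite -subr_eq0 -[u - v]rVpolyK uv0 linear0.
  by rewrite -nN size_poly.
have prim2 : (2 * N).-primitive_root alpha by rewrite -nN.
rewrite hE; split=> m4; split.
(* The two counts give [4 * (d + 1) = 2 * 3 ^ m - 2]. *)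
- have [_ + + _] := cnt3 m4; move: (code_dim C) cT => d; rewrite /n.
  by move: (w3_count m 3) (w3_count m 2) (3 ^ m)%N; clear; lia.
- move=> u v uC vC uv; apply: wt => // p p0 szp pZ; move: nE m4 pZ; rewrite mE => nE m4 pZ.
  exact: (wt_dual12_mod3 h_gt0 nE prim2 szp p0 pZ m4).
(* Here they give [4 * (d + 1) = 2 * 3 ^ m + 2]. *)
- have [_ + + _] := cnt1 m4; move: (code_dim C) cT => d; rewrite /n.
  by move: (w3_count m 3) (w3_count m 2) (3 ^ m)%N; clear; lia.
- move=> u v uC vC uv; apply: wt => // p p0 szp pZ; move: nE m4 pZ; rewrite mE => nE m4 pZ.
  exact: (wt_dual12_mod1 h_gt0 nE prim2 szp p0 pZ m4).
Qed.
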